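(* In the Expected-Vickrey Auction, truthfulness (participating, reporting the true type and fully revealing the information variable) forms a Bayes-Nash equilibrium in the ex-post stage, i.e. the auction is ex-post IIC and ex-post IR; and this equilibrium achieves maximum welfare: at every type profile $\boldsymbol t$ and fully revealed information profile $\boldsymbol\sigma$ the item goes to a bidder attaining $\max_i v_i(t_i;\sigma_i)$, so for every $\boldsymbol t$ the expected welfare equals $\mathbf{E}_{\boldsymbol\sigma\sim\boldsymbol\tau}\big[\max_i v_i(t_i;\sigma_i)\big]$.
   Context: Setting. A single item is auctioned to $n$ bidders. Bidder $i$ has a (possibly infinite) type set $T_i$, a finite state set $\Theta_i$ and a value function $v_i:T_i\times\Theta_i\to\mathbb{R}$. Write $T=\prod_i T_i$, $\Theta=\prod_i\Theta_i$, and $\Delta(X)$ for the probability distributions on $X$. The state profile $\boldsymbol\theta$ is drawn from a prior $g\in\Delta(\Theta)$ with marginals $g_i$ (states may be correlated). Types $t_i\sim h_i$ are independent across bidders and independent of states and signals. An experiment of bidder $i$ is $\tau_i\in\Delta(\Delta(\Theta_i))$ with mean $g_i$; its outcome $\sigma_i\in\Delta(\Theta_i)$ is the posterior belief on $\theta_i$, i.e. $\Pr(\theta_i\mid\sigma_i)=\sigma_i(\theta_i)$. Write $\tau_i\geq_{\mathrm{MPS}}\lambda_i$ if $\sigma_i\sim\tau_i$ and $s_i\sim\lambda_i$ can be coupled so that $\mathbf{E}[\sigma_i\mid s_i]=s_i$. Bidder $i$ privately observes $t_i$ and $\sigma_i\sim\tau_i$ (not $\theta_i$). Standing assumption: $\theta_i\perp\sigma_j\mid\sigma_i$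 for all $i\neq j$, so that once $\sigma_i$ is known the other bidders' signals do not change the belief about $\theta_i$. Bidder $i$ acts by reporting $b_i\in T_i$ and committing to an experiment $\lambda_i$ with $\tau_i\geq_{\mathrm{MPS}}\lambda_i$ ($\lambda_i=\tau_i$ is full revelation); the auctioneer sees $\boldsymbol b$ and $\boldsymbol s=(s_1,\dots,s_n)$, $s_i\sim\lambda_i$. Inference. Given $\boldsymbol\theta$, signals are independent across bidders, so $\boldsymbol s$ has joint distribution $\boldsymbol\lambda(\boldsymbol s)=\sum_{\boldsymbol\theta}g(\boldsymbol\theta)\prod_i s_i(\theta_i)\lambda_i(s_i)/g_i(\theta_i)$ and the posterior is $\Pr(\boldsymbol\theta\mid\boldsymbol s)\propto g(\boldsymbol\theta)\prod_i s_i(\theta_i)/g_i(\theta_i)$. Let $v_i(b_i;\boldsymbol s)=\sum_{\boldsymbol\theta}\Pr(\boldsymbol\theta\mid\boldsymbol s)v_i(b_i;\theta_i)$. If bidder $i$ fully reveals $\sigma_i$ then $v_i(b_i;\sigma_i,s_{-i})=v_i(b_i;\sigma_i):=\sum_{\theta_i}\sigma_i(\theta_i)v_i(b_i;\theta_i)$. $\boldsymbol\tau$ denotes the joint distribution of $\boldsymbol\sigma$ under full revelation. Expected-Vickrey Auction. On input $(\boldsymbol b,\boldsymbol s)$, the item is allocated to the bidder $i=\arg\max_j v_j(b_j;\boldsymbol s)$ (ties broken by a fixed rule), who pays $\max_{j\ne i}v_j(b_j;\boldsymbol s)$; all others get and pay nothing. Truthfulness. For a mechanism $(x,p)$ and true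 type $t_i$, $\mathtt U_i(\boldsymbol b;\boldsymbol s)=x_i(\boldsymbol b;\boldsymbol s)v_i(t_i;\boldsymbol s)-p_i(\boldsymbol b;\boldsymbol s)$ and $\bar{\mathtt U}_i(\boldsymbol b;\boldsymbol\lambda)=\mathbf{E}_{\boldsymbol s\sim\boldsymbol\lambda}[\mathtt U_i(\boldsymbol b;\boldsymbol s)]$. Ex-post IIC: $\bar{\mathtt U}_i(t_i,t_{-i};\tau_i,\tau_{-i})\ge\bar{\mathtt U}_i(b_i,t_{-i};\lambda_i,\tau_{-i})$ for every $i$, all $t_i,b_i\in T_i$, $t_{-i}\in T_{-i}$ and every $\lambda_i$ with $\tau_i\geq_{\mathrm{MPS}}\lambda_i$. Ex-post IR: $\mathtt U_i(t_i,t_{-i};\sigma_i,\sigma_{-i})\ge0$ for every $i$, every truthful type profile and every fully revealing signal profile. ''Maximum welfare'' is with respect to expected values given $(\boldsymbol t,\boldsymbol\sigma)$, since $\boldsymbol\theta$ is observed by nobody; the maximum achievable welfare given $(\boldsymbol t,\boldsymbol\sigma)$ is taken to be $\max_i v_i(t_i;\sigma_i)$. *)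

(* Defs.v *)
From HB Require Import structures.
From mathcomp Require Import all_boot all_order all_algebra.
From mathcomp Require Import all_classical all_reals all_analysis.
From mathcomp Require Import measurable_realfun.

Set Implicit Arguments.
Unset Strict Implicit.
Unset Printing Implicit Defensive.

Import Order.TTheory GRing.Theory Num.Theory.

Local Open Scope classical_set_scope.
Local Open Scope ring_scope.

(* Nonempty finite types: measurable types are pointed in the library, and
   probability distributions on X exist only when X is nonempty. *)
#[short(type="finPointedType")]
HB.structure Definition FinPointed := {T of Finite T & Pointed T}.

Record belief (R : realType) (X : finType) := Belief {
  mass :> X -> R ;
  mass_ge0 : forall x, 0 <= mass x ;
  mass_sum1 : \sum_x mass x = 1 }.

Definition belief_display : measure_display. Proof. exact. Qed.

Section belief_measurable.
Context (R : realType) (X : finPointedType).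

HB.instance Definition _ := gen_eqMixin (belief R X).
HB.instance Definition _ := gen_choiceMixin (belief R X).

Let pm (x : X) : R := (x == point)%:R.
Let pm_ge0 x : 0 <= pm x. Proof. exact: ler0n. Qed.
Let pm_sum1 : \sum_x pm x = 1.
Proof.
rewrite (bigD1 point) //= /pm eqxx big1 ?addr0 // => x xp.
by rewrite (negbTE xp).
Qed.

HB.instance Definition _ := isPointed.Build (belief R X) (Belief pm_ge0 pm_sum1).

(* The smallest sigma-algebra making all the evaluations measurable; this is
   the Borel sigma-algebra of the simplex. *)
Definition belief_sigma : set (set (belief R X)) :=
  <<s \bigcup_(x in [set: X])
        preimage_set_system setT (fun b : belief R X => b x) measurable >>.

HB.instance Definition _ := @isMeasurable.Build belief_display (belief R X)
  belief_sigma (@sigma_algebra0 _ _ _) (@sigma_algebraC _ _)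
  (@sigma_algebra_bigcup _ _ _).

Lemma measurable_mass (x : X) :
  measurable_fun setT (fun b : belief R X => b x).
Proof.
move=> _ B mB; apply: sub_sigma_algebra; exists x => //.
by exists B.
Qed.

End belief_measurable.

Definition profile (I : Type) (X : I -> Type) := forall i, X i.

Definition profile_display : measure_display -> measure_display.
Proof. exact. Qed.

Section profile_measurable.
Context d (I : finType) (X : I -> measurableType d).

HB.instance Definition _ := gen_eqMixin (profile X).
HB.instance Definition _ := gen_choiceMixin (profile X).
HB.instance Definition _ :=
  isPointed.Build (profile X) (fun i => point : X i).

Definition profile_sigma (D : set I) : set (set (profile X)) :=
  <<s \bigcup_(i in D)
        preimage_set_system setT (fun s : profile X => s i) measurable >>.

HB.instance Definition _ := @isMeasurable.Build (profile_display d) (profile X)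
  (profile_sigma setT) (@sigma_algebra0 _ _ _) (@sigma_algebraC _ _)
  (@sigma_algebra_bigcup _ _ _).

Lemma measurable_coord (i : I) : measurable_fun setT (fun s : profile X => s i).
Proof.
move=> _ B mB; apply: sub_sigma_algebra; exists i => //.
by exists B.
Qed.

Lemma measurable_profile d' (T : measurableType d') (f : T -> profile X) :
  (forall i, measurable_fun setT (fun x => f x i)) -> measurable_fun setT f.
Proof.
move=> mf; apply: (measurability (\bigcup_(i in setT) preimage_set_system setT
  (fun s : profile X => s i) measurable)) => //.
move=> _ [_ [i _ [B mB <-] <-]].
by rewrite !setTI; have := mf i measurableT B mB; rewrite setTI.
Qed.

End profile_measurable.

Section product_measure.
Context d (I : finType) (X : I -> measurableType d) (R : realType).

Definition put (i : I) (p : profile X * X i) : profile X :=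
  eqtype.dfwith p.1 p.2.

Lemma measurable_put i : measurable_fun setT (@put i).
Proof.
apply: measurable_profile => j; rewrite /put.
case: (eqVneq i j) => [<-|ij].
  rewrite (_ : (fun _ => _) = snd); first exact: measurable_snd.
  by apply/funext => p; rewrite dfwith_in.
rewrite (_ : (fun _ => _) = (fun s : profile X => s j) \o fst).
  by apply: measurableT_comp; [exact: measurable_coord|exact: measurable_fst].
by apply/funext => p /=; rewrite dfwith_out.
Qed.

Section resample.
Variables (mu : probability (profile X) R) (i : I) (nu : probability (X i) R).

Definition resample : set (profile X) -> \bar R :=
  pushforward (mu \x nu)%E (@put i).

Let resample0 : (resample set0 = 0)%E.
Proof. by rewrite /resample /pushforward preimage_set0 measure0. Qed.

Let resample_ge0 A : (0 <= resample A)%E.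
Proof. by rewrite /resample /pushforward; exact: measure_ge0. Qed.

Let resample_sigma_additive : semi_sigma_additive resample.
Proof.
move=> F mF tF mUF.
rewrite /resample /pushforward preimage_bigcup.
have mput B : measurable B -> measurable (@put i @^-1` B).
  by move=> mB; rewrite -[X in measurable X]setTI; exact: measurable_put.
apply: measure_semi_sigma_additive.
- by move=> k; exact: mput.
- apply/trivIsetP => /= j k _ _ jk; rewrite -preimage_setI.
  by move/trivIsetP : tF => /(_ _ _ _ _ jk) ->//; rewrite preimage_set0.
- by rewrite -preimage_bigcup; exact: mput.
Qed.

HB.instance Definition _ := isMeasure.Build _ _ _ resample
  resample0 resample_ge0 resample_sigma_additive.

Let resample_setT : resample setT = 1%E.
Proof.
rewrite /resample /pushforward preimage_setT -setXTT product_measure1E//.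
by rewrite -[RHS]mule1; congr (_ * _)%E; exact: probability_setT.
Qed.

HB.instance Definition _ :=
  @Measure_isProbability.Build _ _ R resample resample_setT.

End resample.

Definition resamples (lam : forall i, probability (X i) R) (r : seq I) :
    probability (profile X) R :=
  foldr (fun i mu => resample mu (lam i)) (\d_ point) r.

(* Independent product: every coordinate of a constant profile is redrawn, in
   turn, from its own distribution.  prodP_box is the usual characterization. *)
Definition prodP lam := resamples lam (enum I).

Lemma resamples_box lam r (B : forall i, set (X i)) : uniq r ->
  (forall i, measurable (B i)) ->
  resamples lam r [set s | forall i, B i (s i)] =
  (\prod_(i <- r) lam i (B i) *
   \d_ (point : profile X) [set s | forall i, i \notin r -> B i (s i)])%E.
Proof.
elim: r B => [|i r IH] B /=.
  move=> _ mB; rewrite big_nil mul1e; congr dirac.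
  by apply/seteqP; split=> s h j //=; apply: h.
move=> /andP[ir ur] mB; rewrite big_cons /resample /pushforward.
pose B' j : set (X j) := if j == i then setT else B j.
have -> : @put i @^-1` [set s | forall j, B j (s j)] =
          [set s | forall j, B' j (s j)] `*` B i.
  apply/seteqP; split=> [[s x] /= h|[s x] /= [h hx] j].
    split; last by have := h i; rewrite /put dfwith_in.
    move=> j; rewrite /B'; case: (eqVneq j i) => // ji.
    by have := h j; rewrite /put dfwith_out // eq_sym.
  rewrite /put; case: (eqVneq i j) => [ij|ij].
    by case: j / ij; rewrite dfwith_in.
  by have := h j; rewrite /B' eq_sym (negbTE ij) dfwith_out.
have mB' j : measurable (B' j) by rewrite /B'; case: ifP.
have -> : (resamples lam r \x lam i)%E
    ([set s | forall j, B' j (s j)] `*` B i) =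
    (resamples lam r [set s | forall j, B' j (s j)] * lam i (B i))%E.
  apply: product_measure1E => //.
  rewrite (_ : [set s | _] = \bigcap_(j in [set: I])
     [set s : profile X | B' j (s j)]).
    apply: fin_bigcap_measurable; first exact: finite_finset.
    move=> j _.
    by have := @measurable_coord _ _ X j measurableT _ (mB' j); rewrite setTI.
  by apply/seteqP; split=> s h j //=; exact: h.
rewrite IH // muleAC [X in (X * _)%E]muleC; congr (_ * _ * _)%E.
  rewrite big_seq [RHS]big_seq; apply: eq_bigr => j jr; rewrite /B'.
  by case: eqP jr ir => // -> ->.
congr dirac; apply/seteqP; split=> s /= h j.
  rewrite inE negb_or => /andP[ji jr].
  by have := h j jr; rewrite /B' (negbTE ji).
move=> jr; rewrite /B'; case: (eqVneq j i) => // ji.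
by apply: h; rewrite inE negb_or ji.
Qed.

Lemma prodP_box lam (B : forall i, set (X i)) :
  (forall i, measurable (B i)) ->
  prodP lam [set s | forall i, B i (s i)] = (\prod_i lam i (B i))%E.
Proof.
move=> mB; rewrite /prodP resamples_box ?enum_uniq // big_enum /=.
rewrite (_ : [set s | _] = setT) ?diracT ?mule1 //.
by apply/seteqP; split=> // s _ i; rewrite mem_enum.
Qed.

End product_measure.

Section information.
Context (R : realType) (n : nat) (Theta : 'I_n -> finPointedType).

Definition states : finType := {dffun forall i : 'I_n, Theta i}.

Definition signal (i : 'I_n) : measurableType belief_display :=
  belief R (Theta i).

Definition signals : measurableType (profile_display belief_display) :=
  profile signal.

Variable g : belief R states.

Definition marginal (i : 'I_n) (x : Theta i) : R :=
  \sum_(theta : states | theta i == x) g theta.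

(* Density at (theta, s) of the law of the states and the signals, relative to
   the product of the signal distributions: given theta_i, the signal s_i has
   density s_i(theta_i) / g_i(theta_i).  When g_i(theta_i) = 0, the prior
   g theta vanishes as well. *)
Definition weight (s : signals) (theta : states) : R :=
  g theta * \prod_i (s i (theta i) / marginal (theta i)).

Definition density (s : signals) : R := \sum_theta weight s theta.

(* 0 where the density vanishes, which is a null event. *)
Definition posterior (s : signals) (theta : states) : R :=
  weight s theta / density s.

Lemma marginal_ge0 i (x : Theta i) : 0 <= marginal x.
Proof. by apply: sumr_ge0 => theta _; exact: mass_ge0. Qed.

Lemma weight_ge0 s theta : 0 <= weight s theta.
Proof.
rewrite mulr_ge0 ?mass_ge0 // prodr_ge0 // => i _.
by rewrite divr_ge0 ?mass_ge0 ?marginal_ge0.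
Qed.

Lemma density_ge0 s : 0 <= density s.
Proof. by apply: sumr_ge0 => theta _; exact: weight_ge0. Qed.

Lemma measurable_weight theta : measurable_fun setT (weight ^~ theta).
Proof.
apply: measurable_funM => //; apply: measurable_prod => i _.
apply: measurable_funM => //.
apply: (measurableT_comp (f := fun b : signal i => b (theta i))).
  exact: measurable_mass.
exact: measurable_coord.
Qed.

Lemma measurable_density : measurable_fun setT density.
Proof. by apply: measurable_sum => theta; exact: measurable_weight. Qed.

Definition experiments := forall i, probability (signal i) R.

Definition experiment (i : 'I_n) (lam : probability (signal i) R) : Prop :=
  forall x : Theta i, (\int[lam]_b (b x)%:E = (marginal x)%:E)%E.

(* sigma ~ tau and s ~ lam have a coupling in which E[sigma | s] = s. *)
Definition mps (i : 'I_n) (tau lam : probability (signal i) R) : Prop :=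
  exists pi : probability (signal i * signal i)%type R,
    [/\ forall A, measurable A -> pi (fst @^-1` A) = tau A,
        forall A, measurable A -> pi (snd @^-1` A) = lam A &
        forall (x : Theta i) A, measurable A ->
          (\int[pi]_(p in snd @^-1` A) (p.1 x)%:E =
           \int[pi]_(p in snd @^-1` A) (p.2 x)%:E)%E].

Section law.
Variable lam : experiments.

(* Pr(theta \in E, s \in A) *)
Definition joint (E : {set states}) (A : set signals) : \bar R :=
  (\sum_(theta in E) \int[prodP lam]_(s in A) (weight s theta)%:E)%E.

Definition signal_law (A : set signals) : \bar R :=
  (\int[prodP lam]_(s in A) (density s)%:E)%E.

Let signal_law0 : signal_law set0 = 0%E.
Proof. by rewrite /signal_law integral_set0. Qed.

Let signal_law_ge0 A : (0 <= signal_law A)%E.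
Proof. by apply: integral_ge0 => s _; rewrite lee_fin density_ge0. Qed.

Let signal_law_sigma_additive : semi_sigma_additive signal_law.
Proof.
move=> F mF tF mUF; rewrite /signal_law ge0_integral_bigcup //.
- apply: is_cvg_ereal_nneg_natsum_cond => k _ _.
  exact: signal_law_ge0.
- apply/measurable_EFinP/measurable_funTS; exact: measurable_density.
- by move=> s _; rewrite lee_fin density_ge0.
Qed.

HB.instance Definition _ := isMeasure.Build _ _ _ signal_law
  signal_law0 signal_law_ge0 signal_law_sigma_additive.

(* q(s_i) is a version of Pr(theta \in E, s \in A | s_i). *)
Definition cond_prob (i : 'I_n) (E : {set states}) (A : set signals)
    (q : signal i -> R) : Prop :=
  measurable_fun setT q /\
  forall C : set (signal i), measurable C ->
    (joint E (A `&` [set s | C (s i)]) =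
     \int[signal_law]_(s in [set s | C (s i)]) (q (s i))%:E)%E.

(* Conditional independence of theta_i and (s_j)_{j != i} given s_i. *)
Definition state_indep (i : 'I_n) : Prop :=
  forall (E : {set Theta i}) (A : set signals),
    profile_sigma [set j | j != i] A ->
    exists qE qA : signal i -> R,
      [/\ cond_prob [set theta : states | theta i \in E]%SET setT qE,
          cond_prob [set: states]%SET A qA &
          cond_prob [set theta : states | theta i \in E]%SET A
            (fun b => qE b * qA b)].

Definition support (i : 'I_n) (mu : probability (signal i) R) :
    set (signal i) :=
  [set b | forall e : R, 0 < e ->
     (0 < mu [set b' | forall x, (`|b' x - b x| < e)%R])%E].

(* Signal profiles that may arise: every s_i is in the support of its
   experiment and the posterior given s is defined. *)
Definition possible (s : signals) : Prop :=
  (forall i, support (lam i) (s i)) /\ 0 < density s.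

End law.

End information.

Section auction.
Context (R : realType) (n : nat) (T : 'I_n -> Type).
Context (Theta : 'I_n -> finPointedType).
Variables (v : forall i, T i -> Theta i -> R) (g : belief R (states Theta)).

Local Notation signals := (signals R Theta).
Local Notation types := (profile T).

(* v_i(b_i; s) *)
Definition value (i : 'I_n) (b : T i) (s : signals) : R :=
  \sum_(theta : states Theta) posterior g s theta * v b (theta i).

(* v_i(b_i; sigma_i) *)
Definition own_value (i : 'I_n) (b : T i) (sigma : signal R Theta i) : R :=
  \sum_(x : Theta i) sigma x * v b x.

Record mechanism := Mechanism {
  alloc : types -> signals -> 'I_n -> R ;
  payment : types -> signals -> 'I_n -> R }.

Definition utility (M : mechanism) (i : 'I_n) (t : T i) (b : types)
    (s : signals) : R :=
  alloc M b s i * value t s - payment M b s i.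

Definition expected_utility (M : mechanism) (i : 'I_n) (t : T i) (b : types)
    (lam : experiments R Theta) : \bar R :=
  (\int[signal_law g lam]_s (utility M t b s)%:E)%E.

Definition expost_IIC (tau : experiments R Theta) (M : mechanism) : Prop :=
  forall (i : 'I_n) (t : types) (b : T i)
         (lam : probability (signal R Theta i) R),
    mps (tau i) lam ->
    (expected_utility M (t i) (eqtype.dfwith t b) (eqtype.dfwith tau lam)
       <= expected_utility M (t i) t tau)%E.

Definition expost_IR (M : mechanism) : Prop :=
  forall (i : 'I_n) (t : types) (sigma : signals),
    0 <= utility M (t i) t sigma.

(* Maximum of f over a nonempty set of bidders. *)
Definition max_over (P : pred 'I_n) (f : 'I_n -> R) : R :=
  fine (\big[maxe/-oo%E]_(i | P i) (f i)%:E).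

(* The tie-breaking rule selects a bidder from the set of the highest ones. *)
Definition winner (tie : {set 'I_n} -> 'I_n) (b : types) (s : signals) : 'I_n :=
  tie [set i | [forall j, value (b j) s <= value (b i) s]]%SET.

Definition expected_vickrey (tie : {set 'I_n} -> 'I_n) : mechanism :=
  {| alloc b s i := (i == winner tie b s)%:R ;
     payment b s i := if i == winner tie b s
       then max_over (fun j => j != i) (fun j => value (b j) s) else 0 |}.

Definition welfare (M : mechanism) (t : types) (s : signals) : R :=
  \sum_i alloc M t s i * value (t i) s.

End auction.

(* Main.v *)
(* Write P for the product of the experiments and f for the density of the
   signals with respect to P.  Conditional independence says that, P-almost
   everywhere, the posterior law of theta_i given the whole profile s is s_i, so
   that v_i(t_i; s) = v_i(t_i; s_i) for every i.  Both sides, multiplied by f,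
   are polynomials in the masses of s, so the identity extends by continuity to
   the product of the supports.

   For incentives, a Vickrey utility with any report b_i is at most
   (v_i(t_i; s) - max_{j <> i} v_j(t_j; s))^+, with equality when b_i = t_i.
   Multiplied by f, this would be the positive part of a minimum of functions
   linear in s_i, to which Jensen's inequality does not apply.  But
   f v_j(t_j; s) = f v_j(t_j; s_j) for j <> i, and both sides are linear in s_i,
   so this identity survives when bidder i garbles its signal.  Hence the bound
   is almost everywhere the positive part of one function linear in s_i, and
   Jensen's inequality shows that garbling cannot increase its integral. *)
Require Import Defs.
From HB Require Import structures.
From mathcomp Require Import all_boot all_order all_algebra.
From mathcomp Require Import all_classical all_reals all_analysis.
From mathcomp Require Import measurable_realfun ring lra.

Set Implicit Arguments.
Unset Strict Implicit.
Unset Printing Implicit Defensive.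

Import Order.TTheory GRing.Theory Num.Theory.
Import numFieldNormedType.Exports.

Local Open Scope classical_set_scope.
Local Open Scope ring_scope.

(** * Measures with a density *)

Section measure_complements.
Local Open Scope ereal_scope.
Context d (T : measurableType d) (R : realType).

(** No measurability is assumed: a simple function below the positive part of [f] is also below [h].
    This bounds the expected utility of a deviation directly. *)
Lemma le_integral_ge0 (mu : {measure set T -> \bar R}) (f h : T -> \bar R) :
  (forall x, 0 <= h x) -> (forall x, f x <= h x) ->
  \int[mu]_x f x <= \int[mu]_x h x.
Proof.
move=> h0 fh; rewrite [leRHS]ge0_integralTE// [leLHS]integralE.
apply: (@le_trans _ _ (\int[mu]_x f^\+ x)).
  by rewrite -[leRHS]sube0; apply: leeB => //; exact: integral_ge0.
rewrite ge0_integralTE//; apply: le_ereal_sup => _ /= [s sf <-].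
exists s => // x; apply: le_trans (sf x) _.
by rewrite funeposE ge_max fh h0.
Qed.

(* Uniqueness of the Radon-Nikodym derivative identifies f with the library's
   derivative of nu, for which the change of measure is known. *)
Lemma integral_density (mu : {sigma_finite_measure set T -> \bar R})
    (nu : {measure set T -> \bar R}) (f h : T -> \bar R) :
  nu setT < +oo -> measurable_fun setT f ->
  (forall A, measurable A -> nu A = \int[mu]_(x in A) f x) ->
  measurable_fun setT h -> (forall x, 0 <= h x) ->
  \int[nu]_x h x = \int[mu]_x (h x * f x).
Proof.
move=> nuT mf nuE mh h0.
have nufin : fin_num_fun nu.
  move=> A mA; rewrite ge0_fin_numE//; apply: le_lt_trans nuT.
  by apply: le_measure; rewrite ?inE.
have nusigma : sigma_finite setT nu.
  by apply: fin_num_fun_sigma_finite => //; rewrite measure0.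
pose H1 := isFinite.Build _ _ _ _ nufin.
pose H2 := isSFinite.Build _ _ _ _ (sfinite_measure_sigma_finite nusigma).
pose H3 := isSigmaFinite.Build _ _ _ _ nusigma.
pose nu' := HB.pack_for (FiniteMeasure.type T R) (Measure.sort nu) H1 H2 H3.
have dom : nu' `<< mu.
  apply/null_content_dominatesP => A mA muA0; rewrite /= nuE//.
  by apply: null_set_integral => //; exact: measurable_funTS.
transitivity (\int[nu']_x h x); first exact: eq_measure_integral.
rewrite -(Radon_Nikodym_SigmaFinite.change_of_variables dom)//.
have mF := measurable_int _ (Radon_Nikodym_SigmaFinite.f_integrable dom).
apply: ae_eq_integral => //; [exact: emeasurable_funM|exact: emeasurable_funM|].
have : ae_eq mu setT (Radon_Nikodym_SigmaFinite.f nu' mu) f.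
  apply: integral_ae_eq => //.
    exact: Radon_Nikodym_SigmaFinite.f_integrable.
  by move=> A _ mA; rewrite -Radon_Nikodym_SigmaFinite.f_integral// -nuE.
by apply: filterS => x + _ => /(_ Logic.I) ->.
Qed.

Section integral_measure.
Variables (mu : {measure set T -> \bar R}) (f : T -> R).
Hypotheses (mf : measurable_fun setT f) (f0 : forall x, (0 <= f x)%R).

(* The proofs are arguments so that the measure structure can be inferred. *)
Definition integral_measure (_ : measurable_fun setT f)
  (_ : forall x, (0 <= f x)%R) (A : set T) := \int[mu]_(x in A) (f x)%:E.

Local Notation nu := (integral_measure mf f0).

Let nu0 : nu set0 = 0.
Proof. by rewrite /integral_measure integral_set0. Qed.

Let nu_ge0 A : 0 <= nu A.
Proof. by apply: integral_ge0 => x _; rewrite lee_fin. Qed.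

Let nu_sigma_additive : semi_sigma_additive nu.
Proof.
move=> F mF tF mUF; rewrite /integral_measure ge0_integral_bigcup//.
- by apply: is_cvg_ereal_nneg_natsum_cond => k _ _; exact: nu_ge0.
- by apply/measurable_EFinP; exact: measurable_funTS.
- by move=> x _; rewrite lee_fin.
Qed.

HB.instance Definition _ := isMeasure.Build _ _ _ nu
  nu0 nu_ge0 nu_sigma_additive.

End integral_measure.

End measure_complements.

(** * Product measures *)

Section product_measure_complements.
Context d (I : finType) (X : I -> measurableType d) (R : realType).

Definition box (B : forall i, set (X i)) : set (profile X) :=
  [set s | forall i, B i (s i)].

Lemma boxE (B : forall i, set (X i)) :
  box B = \bigcap_(i in [set: I]) [set s : profile X | B i (s i)].
Proof. by apply/seteqP; split=> s h j //=; exact: h. Qed.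

Lemma measurable_coordP (i : I) (B : set (X i)) : measurable B ->
  measurable [set s : profile X | B (s i)].
Proof.
by move=> mB; have := @measurable_coord _ _ X i measurableT _ mB; rewrite setTI.
Qed.

Lemma measurable_box (B : forall i, set (X i)) :
  (forall i, measurable (B i)) -> measurable (box B).
Proof.
move=> mB; rewrite boxE; apply: fin_bigcap_measurable.
  exact: finite_finset.
by move=> j _; exact: measurable_coordP.
Qed.

(** Boxes are stable under intersection, include the whole space and generate the product
    sigma-algebra. *)
Lemma measure_eq_box (m1 m2 : {measure set (profile X) -> \bar R}) :
  (m1 setT < +oo)%E ->
  (forall B : forall i, set (X i), (forall i, measurable (B i)) ->
     m1 (box B) = m2 (box B)) ->
  forall A, measurable A -> m1 A = m2 A.
Proof.
move=> m1T m12.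
pose G := [set box B | B in [set B : forall i, set (X i) |
  forall i, measurable (B i)]].
have GT : G setT.
  by exists (fun i => setT) => // ; apply/seteqP; split.
apply: (measure_unique G (fun=> setT)) => //.
- apply/seteqP; split.
    apply: smallest_sub; first exact: smallest_sigma_algebra.
    move=> _ [i _ [B mB <-]]; apply: sub_sigma_algebra.
    (* A cylinder is the box with full sides at all the other coordinates. *)
    exists (eqtype.dfwith (fun j => setT : set (X j)) B).
      by move=> j /=; case: eqtype.dfwithP.
    apply/seteqP; split=> [s /(_ i)|s [_ Bs] j]; first by rewrite dfwith_in.
    by case: eqtype.dfwithP.
  apply: smallest_sub; first exact: sigma_algebra_measurable.
  by move=> _ [B mB <-]; exact: measurable_box.
- move=> _ _ [B mB <-] [C mC <-]; exists (fun i => B i `&` C i).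
    by move=> i /=; exact: measurableI.
  by apply/seteqP; split=> [s h|s [h1 h2] i]; split => // i; have [] := h i.
- by rewrite bigcup_const.
- by move=> _ [B mB <-]; exact: m12.
Qed.

(** Taken as densities, [f] and [h] define measures that agree on boxes, hence on all measurable
    sets. *)
Lemma ae_eq_box (mu : {measure set (profile X) -> \bar R})
    (f h : profile X -> R) :
  mu.-integrable setT (EFin \o f) -> measurable_fun setT h ->
  (forall s, 0 <= f s) -> (forall s, 0 <= h s) ->
  (forall B : forall i, set (X i), (forall i, measurable (B i)) ->
     (\int[mu]_(s in box B) (f s)%:E = \int[mu]_(s in box B) (h s)%:E)%E) ->
  ae_eq mu setT (EFin \o f) (EFin \o h).
Proof.
move=> intf mh f0 h0 fh.
have mf : measurable_fun setT f.
  by apply/measurable_EFinP; exact: measurable_int intf.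
apply: integral_ae_eq => //; first exact/measurable_EFinP.
move=> A _ mA.
apply: (@measure_eq_box (integral_measure mu mf f0)
  (integral_measure mu mh h0)) => //.
rewrite /= /integral_measure; case/integrableP: intf => _; apply: le_lt_trans.
apply: ge0_le_integral => //.
- by move=> x _; rewrite lee_fin.
- exact/measurable_EFinP.
- by apply: measurableT_comp => //; exact/measurable_EFinP.
- by move=> x _; rewrite lee_fin ler_norm.
Qed.

(** Redrawing coordinate [i] replaces the factor [lam i (B i)] of each box by [nu (B i)]. So the
    coordinate of a deviating bidder can be treated as the last one drawn, whatever the order used
    in [prodP]. *)
Lemma resample_prodP (lam : forall i, probability (X i) R) i
    (nu : probability (X i) R) A : measurable A ->
  resample (prodP lam) nu A = prodP (eqtype.dfwith lam nu) A.
Proof.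
apply: measure_eq_box => [|B mB].
  by rewrite [X in (X < _)%E](probability_setT (resample (prodP lam) nu)) ltry.
rewrite [RHS]prodP_box//.
transitivity ((prodP lam \x nu)%E (@put _ _ X i @^-1` box B)) => //.
have -> : @put _ _ X i @^-1` box B =
    box (eqtype.dfwith B (setT : set (X i))) `*` B i.
  apply/seteqP; split=> [[s x] /= h|[s x] /= [h hx] j].
    split; last by have := h i; rewrite /put dfwith_in.
    move=> j; case: eqtype.dfwithP => // {}j ij.
    by have := h j; rewrite /put dfwith_out.
  rewrite /put /=; case: eqtype.dfwithP => // {}j ij.
  by have := h j; rewrite dfwith_out.
have mBT j : measurable (eqtype.dfwith B (setT : set (X i)) j).
  by case: eqtype.dfwithP.
transitivity
  (prodP lam (box (eqtype.dfwith B (setT : set (X i)))) * nu (B i))%E.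
  by apply: product_measure1E => //; exact: measurable_box.
rewrite [X in (X * _)%E]prodP_box// (bigD1 i)//= [in RHS](bigD1 i)//=.
rewrite !dfwith_in.
rewrite [X in (X * _ * _)%E]probability_setT mul1e muleC; congr (_ * _)%E.
by apply: eq_bigr => j ji; rewrite !dfwith_out// eq_sym.
Qed.

Lemma dfwith_self (lam : forall i, probability (X i) R) i :
  eqtype.dfwith lam (lam i) = lam.
Proof. by apply: functional_extensionality_dep => j; case: eqtype.dfwithP. Qed.

Lemma integral_resample (mu : probability (profile X) R) i
    (nu : probability (X i) R) (f : profile X -> \bar R) :
  measurable_fun setT f -> (forall s, (0 <= f s)%E) ->
  (\int[resample mu nu]_s f s = \int[mu]_s \int[nu]_x f (put (s, x)))%E.
Proof.
move=> mf f0; rewrite /resample.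
rewrite (ge0_integral_pushforward (@measurable_put _ _ X i) (mu \x nu)%E)//.
rewrite preimage_setT fubini_tonelli1//; last by move=> p; exact: f0.
by apply: measurableT_comp => //; exact: measurable_put.
Qed.

(** The deviating coordinate is integrated innermost, with the others held fixed, as Jensen's
    inequality will require. *)
Lemma integral_prodP_dfwith (lam : forall i, probability (X i) R) i
    (nu : probability (X i) R) (f : profile X -> \bar R) :
  measurable_fun setT f -> (forall s, (0 <= f s)%E) ->
  (\int[prodP (eqtype.dfwith lam nu)]_s f s =
   \int[prodP lam]_s \int[nu]_x f (put (s, x)))%E.
Proof.
move=> mf f0; rewrite -integral_resample//.
by apply: eq_measure_integral => A mA _; exact/esym/resample_prodP.
Qed.

Lemma measurable_prod_coord (f : forall i, X i -> \bar R) :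
  (forall i, measurable_fun setT (f i)) ->
  measurable_fun setT (fun s : profile X => \prod_i f i (s i))%E.
Proof.
move=> mf; elim: (index_enum I) => [|i s IH].
  by under eq_fun do rewrite big_nil; exact: measurable_cst.
under eq_fun do rewrite big_cons; apply: emeasurable_funM => //.
by apply: measurableT_comp => //; exact: measurable_coord.
Qed.

Lemma integral_prodP_prod (lam : forall i, probability (X i) R)
    (f : forall i, X i -> \bar R) :
  (forall i, measurable_fun setT (f i)) -> (forall i x, (0 <= f i x)%E) ->
  (\int[prodP lam]_s \prod_i f i (s i) = \prod_i \int[lam i]_x f i x)%E.
Proof.
move=> mf f0; rewrite /prodP.
(* Coordinates outside [r] still sit at [point], so their factors remain in the induction statement.
   It quantifies over [h] because the inductive step alters one factor. *)
suff H (r : seq I) (h : forall i, X i -> \bar R) :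
    (forall i, measurable_fun setT (h i)) -> (forall i x, (0 <= h i x)%E) ->
    uniq r -> (\int[resamples lam r]_s \prod_i h i (s i) =
    \prod_(i <- r) \int[lam i]_x h i x * \prod_(i | i \notin r) h i point)%E.
  rewrite H ?enum_uniq// big_enum/= [X in (_ * X)%E]big_pred0 ?mule1// => i.
  by rewrite mem_enum.
have prod0 (J : seq I) (P : pred I) (g : I -> \bar R) :
    (forall i, (0 <= g i)%E) ->
    (0 <= \prod_(i <- J | P i) g i)%E by move=> g0; apply: prode_ge0.
elim: r h => [|i r IH] h mh h0 /=.
  move=> _; rewrite big_nil mul1e integral_dirac ?diracT ?mul1e//.
  exact: measurable_prod_coord.
move=> /andP[ir ur]; rewrite integral_resample//; last 2 first.
- exact: measurable_prod_coord.
- by move=> s; exact: prod0.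
rewrite big_cons.
(* Setting the factor at [i] to 1 leaves a product that does not depend on the redrawn
   coordinate. *)
pose h' : forall j, X j -> \bar R := eqtype.dfwith h (cst 1%E : X i -> \bar R).
transitivity (\int[resamples lam r]_s
    (\int[lam i]_x h i x * \prod_j h' j (s j)))%E.
  apply: eq_integral => s _.
  under eq_integral => x _.
    rewrite (bigD1 i)//= /put dfwith_in muleC.
    rewrite (_ : \prod_(j | _) _ = \prod_j h' j (s j))%E; first over.
    rewrite [RHS](bigD1 i)//= /h' dfwith_in mul1e; apply: eq_bigr => j ji.
    by rewrite !dfwith_out// eq_sym.
  rewrite ge0_integralZl// 1?muleC//; apply: prod0 => j.
  by rewrite /h'; case: eqtype.dfwithP.
have mh' j : measurable_fun setT (h' j) by rewrite /h'; case: eqtype.dfwithP.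
have h'0 j x : (0 <= h' j x)%E by rewrite /h'; case: eqtype.dfwithP x.
rewrite ge0_integralZl//; last 3 first.
- exact: measurable_prod_coord.
- by move=> s _; exact: prod0.
- by apply: integral_ge0 => x _.
rewrite IH// -muleA; congr (_ * _)%E; congr (_ * _)%E.
  rewrite big_seq [RHS]big_seq; apply: eq_bigr => j jr.
  by rewrite /h' dfwith_out//; apply: contraNneq ir => ->.
rewrite (bigD1 i)//= /h' dfwith_in mul1e.
apply: eq_big => [j|j /andP[_ ji]]; first by rewrite inE negb_or andbC.
by rewrite dfwith_out// eq_sym.
Qed.

End product_measure_complements.

(** * The law of the signals *)

Section information_complements.
Context (R : realType) (n : nat) (Theta : 'I_n -> finPointedType).
Variable g : belief R (states Theta).

Local Notation signals := (signals R Theta).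
Local Notation signal := (signal R Theta).

Lemma mass_le1 (X : finType) (b : belief R X) x : b x <= 1.
Proof.
rewrite -(mass_sum1 b) (bigD1 x)//= lerDl.
by apply: sumr_ge0 => y _; exact: mass_ge0.
Qed.

Lemma marginal_eq0 (theta : states Theta) i :
  marginal g (theta i) = 0 -> g theta = 0.
Proof.
move/eqP; rewrite /marginal psumr_eq0 => [/allP/(_ theta)|j _]; last first.
  exact: mass_ge0.
by rewrite mem_index_enum eqxx /= => /(_ isT)/eqP.
Qed.

Lemma measurable_mass_coord i (x : Theta i) :
  measurable_fun setT (fun s : signals => s i x).
Proof.
apply: (measurableT_comp (f := fun b : signal i => b x)).
  exact: measurable_mass.
exact: measurable_coord.
Qed.

Lemma weight_le s theta :
  weight g s theta <= g theta * \prod_i (marginal g (theta i))^-1.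
Proof.
rewrite /weight ler_wpM2l ?mass_ge0//; apply: ler_prod => i _.
rewrite divr_ge0 ?mass_ge0 ?marginal_ge0//= ler_piMl ?mass_le1//.
by rewrite invr_ge0 marginal_ge0.
Qed.

(** The weight is linear in [b], with coefficients that depend on the other signals only. *)
Lemma weight_put i s (b : signal i) theta :
  weight g (put (s, b)) theta =
  g theta * (b (theta i) / marginal g (theta i) *
    \prod_(j | j != i) (s j (theta j) / marginal g (theta j))).
Proof.
rewrite /weight (bigD1 i)//= /put dfwith_in; congr (_ * (_ * _)).
by apply: eq_bigr => j ji; rewrite dfwith_out// eq_sym.
Qed.

Lemma integrable_weight (mu : probability signals R) theta :
  mu.-integrable setT (fun s => (weight g s theta)%:E).
Proof.
apply: measurable_bounded_integrable => //.
- by rewrite [X in (X < _)%E]probability_setT ltry.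
- exact: measurable_weight.
exists (g theta * \prod_i (marginal g (theta i))^-1); split.
  exact: num_real.
move=> M hM s _ /=; rewrite ger0_norm ?weight_ge0//.
exact: le_trans (weight_le s theta) (ltW hM).
Qed.

Lemma integrable_sum_weight (mu : probability signals R)
    (P : pred (states Theta)) :
  mu.-integrable setT (fun s => (\sum_(theta | P theta) weight g s theta)%:E).
Proof.
under eq_fun do rewrite -sumEFin.
by apply: integrable_sum => // theta _; exact: integrable_weight.
Qed.

Lemma measurable_sum_weight (P : pred (states Theta)) :
  measurable_fun setT (fun s => \sum_(theta | P theta) weight g s theta).
Proof.
rewrite (_ : (fun s => _) = fun s => \sum_(theta <- enum P) weight g s theta).
  by apply: measurable_sum => theta; exact: measurable_weight.
by apply/funext => s; rewrite big_enum.
Qed.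

Lemma sum_weight_ge0 (P : pred (states Theta)) s :
  0 <= \sum_(theta | P theta) weight g s theta.
Proof. by apply: sumr_ge0 => theta _; exact: weight_ge0. Qed.

Lemma density_sum_weight i s :
  density g s = \sum_(x : Theta i)
    \sum_(theta : states Theta | theta i == x) weight g s theta.
Proof.
pose pr (theta : states Theta) := theta i.
by rewrite /density (partition_big pr predT).
Qed.

Section law.
Variable lam : experiments R Theta.

Local Notation P := (prodP lam).

Lemma jointE E A : measurable A ->
  (joint g lam E A =
   \int[P]_(s in A) (\sum_(theta in E) weight g s theta)%:E)%E.
Proof.
move=> mA; under eq_integral do rewrite -sumEFin -big_enum.
rewrite ge0_integral_sum//=; first by rewrite /joint big_enum.
- move=> theta; apply/measurable_EFinP; apply: measurable_funTS.
  exact: measurable_weight.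
- by move=> theta s _; rewrite lee_fin weight_ge0.
Qed.

Lemma signal_law_lty : (signal_law g lam setT < +oo)%E.
Proof.
have /integrableP[_] := integrable_sum_weight P predT.
apply: le_lt_trans; apply: ge0_le_integral => //.
- by move=> s _; rewrite lee_fin density_ge0.
- by apply/measurable_EFinP; exact: measurable_density.
- apply: measurableT_comp => //; apply/measurable_EFinP.
  exact: measurable_sum_weight.
- by move=> s _; rewrite lee_fin ler_norm.
Qed.

Lemma integral_signal_law (h : signals -> \bar R) :
  measurable_fun setT h -> (forall s, 0 <= h s)%E ->
  (\int[signal_law g lam]_s h s = \int[P]_s (h s * (density g s)%:E))%E.
Proof.
move=> mh h0; apply: integral_density => //; first exact: signal_law_lty.
by apply/measurable_EFinP; exact: measurable_density.
Qed.

Hypothesis hlam : forall i, experiment g (lam i).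

(** Each factor with [j != i] integrates to 1, since the mean of [lam j] is the marginal of the
    prior. *)
Lemma integral_mul_weight i (h : signal i -> \bar R) theta :
  measurable_fun setT h -> (forall b, 0 <= h b)%E ->
  (\int[P]_s (h (s i) * (weight g s theta)%:E) =
   (g theta / marginal g (theta i))%:E *
   \int[lam i]_b (h b * (b (theta i))%:E))%E.
Proof.
move=> mh h0.
(* Outside this case no marginal at [theta] vanishes, so all the divisions are genuine. *)
have [gt0|gt0] := eqVneq (g theta) 0.
  rewrite gt0 mul0r mul0e; apply: integral0_eq => s _.
  by rewrite /weight gt0 mul0r mule0.
have m0 j : marginal g (theta j) != 0.
  by apply: contra_neq gt0; exact: marginal_eq0.
pose f0 j (b : signal j) := (b (theta j) / marginal g (theta j))%:E.
(* Absorbing [h] into the factor at [i] makes the integrand a product over coordinates. *)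
pose f : forall j, signal j -> \bar R :=
  eqtype.dfwith f0 (fun b : signal i => (h b * f0 i b)%E).
have mf0 j : measurable_fun setT (f0 j).
  apply/measurable_EFinP; apply: measurable_funM => //; exact: measurable_mass.
have f00 j b : (0 <= f0 j b)%E.
  by rewrite lee_fin divr_ge0 ?mass_ge0 ?marginal_ge0.
have mf j : measurable_fun setT (f j).
  by rewrite /f; case: eqtype.dfwithP => //; exact: emeasurable_funM.
have fge0 j b : (0 <= f j b)%E.
  by rewrite /f; case: eqtype.dfwithP b => // b; rewrite mule_ge0.
transitivity (\int[P]_s ((g theta)%:E * \prod_j f j (s j)))%E.
  apply: eq_integral => s _; rewrite /weight EFinM muleCA; congr (_ * _)%E.
  rewrite -prodEFin (bigD1 i)//= [in RHS](bigD1 i)//= /f dfwith_in muleA.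
  by congr (_ * _)%E; apply: eq_bigr => j ji; rewrite dfwith_out// eq_sym.
rewrite ge0_integralZl//; last 3 first.
- exact: measurable_prod_coord.
- by move=> s _; apply: prode_ge0.
- by rewrite lee_fin mass_ge0.
rewrite integral_prodP_prod// (bigD1 i)//= /f dfwith_in.
rewrite [X in (_ * (_ * X))%E]big1 ?mule1 => [|j ji].
  rewrite EFinM -muleA; congr (_ * _)%E.
  rewrite -ge0_integralZl//; last 3 first.
  - apply: emeasurable_funM => //; apply/measurable_EFinP.
    exact: measurable_mass.
  - by move=> b _; rewrite mule_ge0// lee_fin mass_ge0.
  - by rewrite lee_fin invr_ge0 marginal_ge0.
  by apply: eq_integral => b _; rewrite /f0 EFinM muleA muleC.
under eq_integral do rewrite dfwith_out 1?eq_sym// /f0 EFinM muleC.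
rewrite ge0_integralZl//; last 3 first.
- by apply/measurable_EFinP; exact: measurable_mass.
- by move=> b _; rewrite lee_fin mass_ge0.
- by rewrite lee_fin invr_ge0 marginal_ge0.
by rewrite hlam -EFinM mulVf.
Qed.

(** The coefficients [g theta / marginal g x] over the profiles with [theta i = x] sum to 1, unless
    the marginal is 0. *)
Lemma integral_sum_weight i (h : signal i -> \bar R) (x : Theta i) :
  measurable_fun setT h -> (forall b, 0 <= h b)%E ->
  (\int[P]_s (h (s i) *
     (\sum_(theta : states Theta | theta i == x) weight g s theta)%:E) =
   \int[lam i]_b (h b * (b x)%:E))%E.
Proof.
move=> mh h0.
transitivity (\sum_(theta <- enum [pred theta : states Theta | theta i == x])
    \int[P]_s (h (s i) * (weight g s theta)%:E))%E.
  rewrite -ge0_integral_sum//; last 2 first.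
  - move=> theta; apply: emeasurable_funM.
      by apply: measurableT_comp => //; exact: measurable_coord.
    by apply/measurable_EFinP; exact: measurable_weight.
  - by move=> theta s _; rewrite mule_ge0// lee_fin weight_ge0.
  apply: eq_integral => s _; rewrite -sumEFin ge0_sume_distrr ?big_enum//.
  by move=> theta _; rewrite lee_fin weight_ge0.
rewrite big_enum/=.
under eq_bigr => theta /eqP tx do rewrite integral_mul_weight// tx.
rewrite -ge0_sume_distrl => [|theta _]; last first.
  by rewrite lee_fin divr_ge0 ?mass_ge0 ?marginal_ge0.
rewrite sumEFin -mulr_suml -/(marginal g x).
have [mx0|mx0] := eqVneq (marginal g x) 0; last by rewrite divff// mul1e.
(* A null state has mean mass 0, so [b x] is 0 for almost every [b] and the remaining integral
   vanishes too. *)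
rewrite mx0 mul0r mul0e; apply/esym.
have : (\int[lam i]_b `|(b x)%:E| = 0)%E.
  rewrite -[RHS](congr1 EFin mx0) -hlam; apply: eq_integral => b _.
  by rewrite gee0_abs// lee_fin mass_ge0.
have mx : measurable_fun setT (fun b : signal i => (b x)%:E).
  by apply/measurable_EFinP; exact: measurable_mass.
move/(ae_eq_integral_abs _ measurableT mx) => bx0.
rewrite -[RHS](integral0 (lam i) setT); apply: ae_eq_integral => //.
  exact: emeasurable_funM.
by apply: filterS bx0 => b /(_ Logic.I) /= -> _; rewrite mule0.
Qed.

(** The marginal of the signal law at [i] is [lam i]: [integral_sum_weight] is summed over [x], and
    masses add up to 1. *)
Lemma integral_signal_law_coord i (h : signal i -> \bar R) :
  measurable_fun setT h -> (forall b, 0 <= h b)%E ->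
  (\int[signal_law g lam]_s h (s i) = \int[lam i]_b h b)%E.
Proof.
move=> mh h0; rewrite integral_signal_law//; last first.
  by apply: measurableT_comp => //; exact: measurable_coord.
transitivity (\sum_(x : Theta i) \int[P]_s
    (h (s i) *
      (\sum_(theta : states Theta | theta i == x) weight g s theta)%:E))%E.
  rewrite -ge0_integral_sum//; last 2 first.
  - move=> x; apply: emeasurable_funM.
      by apply: measurableT_comp => //; exact: measurable_coord.
    by apply/measurable_EFinP; exact: measurable_sum_weight.
  - by move=> x s _; rewrite mule_ge0// lee_fin sum_weight_ge0.
  apply: eq_integral => s _; rewrite (density_sum_weight i) -sumEFin.
  by rewrite ge0_sume_distrr// => x _; rewrite lee_fin sum_weight_ge0.
under eq_bigr do rewrite integral_sum_weight//.
rewrite -ge0_integral_sum//; last 2 first.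
- move=> x; apply: emeasurable_funM => //.
  by apply/measurable_EFinP; exact: measurable_mass.
- by move=> x b _; rewrite mule_ge0// lee_fin mass_ge0.
apply: eq_integral => b _; rewrite -ge0_sume_distrr => [|x _]; last first.
  by rewrite lee_fin mass_ge0.
by rewrite sumEFin mass_sum1 mule1.
Qed.

(** Splitting into positive and negative parts removes the sign condition, which versions of
    conditional probabilities need not satisfy pointwise. *)
Lemma integral_signal_law_coord_in i (h : signal i -> \bar R) C :
  measurable C -> measurable_fun setT h ->
  (\int[signal_law g lam]_(s in [set s | C (s i)]) h (s i) =
   \int[lam i]_(b in C) h b)%E.
Proof.
move=> mC mh; rewrite [RHS]integral_mkcond [LHS]integral_mkcond.
have mhC : measurable_fun setT (h \_ C).
  by apply/(measurable_restrictT _ _).1 => //; exact: measurable_funTS.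
transitivity (\int[signal_law g lam]_s ((h \_ C) (s i)))%E.
  apply: eq_integral => s _; rewrite !patchE.
  suff -> : (s \in [set s0 : signals | C (s0 i)]) = (s i \in C) by [].
  by apply/idP/idP; rewrite !inE.
rewrite [LHS]integralE [RHS]integralE; congr (_ - _)%E.
- rewrite -integral_signal_law_coord//; last exact: measurable_funepos.
  by apply: eq_integral => s _; rewrite !funeposE.
- rewrite -integral_signal_law_coord//; last exact: measurable_funeneg.
  by apply: eq_integral => s _; rewrite !funenegE.
Qed.

End law.
End information_complements.

(** * The posterior law of a single state *)

Section posterior_marginal.
Context (R : realType) (n : nat) (Theta : 'I_n -> finPointedType).
Variables (g : belief R (states Theta)) (lam : experiments R Theta).
Hypothesis hlam : forall i, experiment g (lam i).

Local Notation signals := (signals R Theta).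
Local Notation signal := (signal R Theta).
Local Notation P := (prodP lam).

(** Since [lam i] is the law of the signal of bidder [i], a conditional probability given that
    signal is a density relative to [lam i]. *)
Lemma cond_prob_coord i E A (q : signal i -> R) C :
  cond_prob g lam E A q -> measurable C ->
  (joint g lam E (A `&` [set s | C (s i)]) =
   \int[lam i]_(b in C) (q b)%:E)%E.
Proof.
move=> [mq hq] mC; rewrite hq//.
rewrite (integral_signal_law_coord_in _ (h := EFin \o q))//.
exact/measurable_EFinP.
Qed.

Lemma integrable_mass i (mu : probability (signal i) R) (x : Theta i) :
  mu.-integrable setT (fun b => (b x)%:E).
Proof.
apply: measurable_bounded_integrable => //.
- by rewrite [X in (X < _)%E]probability_setT ltry.
- exact: measurable_mass.
exists 1; split; first exact: num_real.
move=> M hM b _ /=; rewrite ger0_norm ?mass_ge0//.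
exact: le_trans (mass_le1 _ _) (ltW hM).
Qed.

(** Hence [b x] is a version of the conditional probability of state [x] given the signal [b]
    alone. *)
Lemma joint_coord i (x : Theta i) (C : set (signal i)) : measurable C ->
  (joint g lam [set theta : states Theta | theta i \in [set x]%SET]%SET
     [set s | C (s i)] = \int[lam i]_(b in C) (b x)%:E)%E.
Proof.
move=> mC; rewrite jointE; last exact: measurable_coordP.
rewrite [RHS]integral_mkcond [LHS]integral_mkcond !epatch_indic.
transitivity (\int[P]_s ((\1_C (s i))%:E *
    (\sum_(theta : states Theta | theta i == x) weight g s theta)%:E))%E.
  apply: eq_integral => s _; rewrite muleC; congr (_ * _)%E.
  by congr EFin; apply: eq_bigl => theta; rewrite inE inE.
rewrite (integral_sum_weight hlam (h := fun b => (\1_C b)%:E))//; last first.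
  by apply/measurable_EFinP; exact: measurable_indic.
by apply: eq_integral => b _; rewrite muleC.
Qed.

Lemma profile_sigma_box (D : set 'I_n) (B : forall i, set (signal i)) :
  (forall i, measurable (B i)) -> (forall i, ~ D i -> B i = setT) ->
  profile_sigma D (box B).
Proof.
move=> mB BT; rewrite boxE.
pose G := \bigcup_(i in D) preimage_set_system setT
  (fun s : profile signal => s i) measurable.
apply: (@fin_bigcap_measurable _ (g_sigma_algebraType G)).
  exact: finite_finset.
move=> j _; have [Dj|nDj] := pselect (D j).
  apply: sub_sigma_algebra; exists j => //; exists (B j) => //.
  by rewrite setTI.
by rewrite BT//; exact: (@measurableT _ (g_sigma_algebraType G)).
Qed.

(** It suffices to compare integrals over boxes. There conditional independence yields the product
    of [qE], which is the mass of [x], and [qA], which is the density of the law of [s i] restricted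
    to an event about the other signals. A change of measure then returns to whole profiles. *)
Lemma sum_weight_ae i (x : Theta i) : state_indep g lam i ->
  ae_eq P setT
    (fun s => (\sum_(theta : states Theta | theta i == x) weight g s theta)%:E)
    (fun s => (s i x * density g s)%:E).
Proof.
move=> hind; apply: ae_eq_box.
- exact: integrable_sum_weight.
- apply: measurable_funM; first exact: measurable_mass_coord.
  exact: measurable_density.
- by move=> s; exact: sum_weight_ge0.
- by move=> s; rewrite mulr_ge0 ?mass_ge0 ?density_ge0.
move=> B mB.
(* Freeing coordinate [i] leaves an event about the other signals only. *)
pose A := box (eqtype.dfwith B (setT : set (signal i))).
have mBT j : measurable (eqtype.dfwith B (setT : set (signal i)) j).
  by case: eqtype.dfwithP.
have mA : measurable A by exact: measurable_box.
have boxBE : box B = A `&` [set s | B i (s i)].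
  apply/seteqP; split=> [s h|s [h hi] j]; first split => // j.
    by case: eqtype.dfwithP.
  by have := h j; case: eqtype.dfwithP.
have /(hind [set x]%SET)[qE [qA [hE hA hEA]]] :
    profile_sigma [set j | j != i] A.
  apply: profile_sigma_box => // j /negP; rewrite negbK => /eqP ->.
  by rewrite dfwith_in.
have qEx : ae_eq (lam i) setT (fun b => (b x)%:E) (EFin \o qE).
  apply: integral_ae_eq => //; first exact: integrable_mass.
    by apply/measurable_EFinP; case: hE.
  by move=> C _ mC; rewrite -(cond_prob_coord hE mC) setTI joint_coord.
pose f s : R := \1_A s * density g s.
have mf : measurable_fun setT f.
  apply: measurable_funM; last exact: measurable_density.
  exact: measurable_indic.
have f0 s : 0 <= f s by rewrite mulr_ge0 ?density_ge0.
(* This is the signal law restricted to [A]; its image under coordinate [i] has density [qA]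
   relative to [lam i]. *)
pose m := integral_measure P mf f0.
have mc : measurable_fun setT (fun s : signals => s i).
  exact: measurable_coord.
pose c : {mfun signals >-> signal i} :=
  HB.pack (fun s : signals => s i) (isMeasurableFun.Build _ _ _ _ _ mc).
have mE (D : set signals) : measurable D ->
    (m D = \int[P]_(s in A `&` D) (density g s)%:E)%E.
  move=> mD; rewrite /m /integral_measure /f.
  rewrite [LHS]integral_mkcond [RHS]integral_mkcond !epatch_indic.
  apply: eq_integral => s _; rewrite -!EFinM indicI/=; congr EFin.
  by ring.
have mc' C : measurable C -> measurable [set s : signals | C (s i)].
  by exact: measurable_coordP.
have nuE C : measurable C ->
    (pushforward m c C = \int[lam i]_(b in C) (qA b)%:E)%E.
  move=> mC; rewrite -(cond_prob_coord hA mC) jointE//; last first.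
    by apply: measurableI => //; exact: mc'.
  rewrite /pushforward mE//; last exact: mc'.
  apply: eq_integral => s _; congr EFin; apply: eq_bigl => theta.
  by rewrite inE.
have mqA : measurable_fun setT (EFin \o qA).
  by apply/measurable_EFinP; case: hA.
pose h (b : signal i) : \bar R := (b x * \1_(B i) b)%:E.
have mh : measurable_fun setT h.
  apply/measurable_EFinP; apply: measurable_funM; first exact: measurable_mass.
  exact: measurable_indic.
have h0 b : (0 <= h b)%E by rewrite lee_fin mulr_ge0 ?mass_ge0.
have mT : (m setT < +oo)%E.
  rewrite mE// setIT; apply: le_lt_trans (signal_law_lty g lam).
  apply: ge0_subset_integral => //.
    by apply/measurable_EFinP; exact: measurable_density.
  by move=> s _; rewrite lee_fin density_ge0.
transitivity (\int[lam i]_b (h b * (qA b)%:E))%E.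
  rewrite boxBE.
  transitivity (joint g lam
      [set theta : states Theta | theta i \in [set x]%SET]%SET
      (A `&` [set s | B i (s i)])).
    rewrite jointE; last by apply: measurableI => //; exact: mc'.
    apply: eq_integral => s _; congr EFin; apply: eq_bigl => theta.
    by rewrite inE inE.
  rewrite (cond_prob_coord hEA (mB i)) [LHS]integral_mkcond epatch_indic.
  apply: ae_eq_integral => //.
  - apply: emeasurable_funM; apply/measurable_EFinP; first by case: hEA.
    exact: measurable_indic.
  - exact: emeasurable_funM.
  apply: filterS qEx => b /(_ Logic.I) /= [<-] _.
  by rewrite /h -!EFinM mulrAC.
(* The density [qA] is absorbed into the image of [m], which is then pulled back to profiles. *)
rewrite -(@integral_density _ _ _ (lam i) (pushforward m c) (EFin \o qA) h)//.
rewrite (ge0_integral_pushforward mc m)// preimage_setT.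
rewrite (integral_density (mu := P) (f := EFin \o f))//; last 3 first.
- by apply/measurable_EFinP.
- exact: measurableT_comp.
- by move=> s; exact: h0.
rewrite boxBE [RHS]integral_mkcond epatch_indic; apply: eq_integral => s _.
rewrite /h /f /= -!EFinM indicI/=; congr EFin.
by ring.
Qed.

End posterior_marginal.

(** * Mean-preserving contractions *)

Section jensen.
Context (R : realType) (n : nat) (Theta : 'I_n -> finPointedType).

Local Notation signals := (signals R Theta).
Local Notation signal := (signal R Theta).

(* Jensen's inequality for the positive part of a linear form L: it suffices to
   compare the integrals of L over the event that L is nonnegative at s. *)
Lemma mps_integral_max0 i (tau lam : probability (signal i) R) (J : finType)
    (c : J -> R) (x : J -> Theta i) : mps tau lam ->
  (\int[lam]_b (Num.max (\sum_j c j * b (x j)) 0)%:E <=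
   \int[tau]_b (Num.max (\sum_j c j * b (x j)) 0)%:E)%E.
Proof.
move=> [pi [pi1 pi2 piE]].
pose L (b : signal i) : R := \sum_j c j * b (x j).
have mL : measurable_fun setT L.
  apply: measurable_sum => j; apply: measurable_funM => //.
  exact: measurable_mass.
have mLmax : measurable_fun setT (fun b => (Num.max (L b) 0)%:E).
  by apply/measurable_EFinP; exact: measurable_maxr.
have Lmax0 b : (0 <= (Num.max (L b) 0)%:E)%E.
  by rewrite lee_fin le_max lexx orbT.
pose N := [set b | 0 <= L b].
have mN : measurable N.
  have := mL measurableT _ (measurable_itv `[0, +oo[).
  rewrite setTI; congr (measurable _).
  by apply/seteqP; split=> b /=; rewrite /N/= in_itv/= andbT.
have mN2 : measurable (@snd (signal i) (signal i) @^-1` N).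
  by rewrite -[X in measurable X]setTI; exact: measurable_snd.
have intq (q : signal i * signal i -> signal i) (y : Theta i) :
    measurable_fun setT q -> pi.-integrable setT (fun p => (q p y)%:E).
  move=> mq; apply: measurable_bounded_integrable => //.
  - by rewrite [X in (X < _)%E]probability_setT ltry.
  - apply: (measurableT_comp (f := fun b : signal i => b y)) => //.
    exact: measurable_mass.
  exists 1; split; first exact: num_real.
  move=> M hM p _ /=; rewrite ger0_norm ?mass_ge0//.
  exact: le_trans (mass_le1 _ _) (ltW hM).
have intL (q : signal i * signal i -> signal i) : measurable_fun setT q ->
    (\int[pi]_(p in snd @^-1` N) (L (q p))%:E =
     \sum_j (c j)%:E * \int[pi]_(p in snd @^-1` N) (q p (x j))%:E)%E.
  move=> mq; have intN y : pi.-integrable (snd @^-1` N) (fun p => (q p y)%:E).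
    by apply: integrableS (intq _ y mq).
  under eq_integral do rewrite /L -sumEFin.
  rewrite integral_sum//=; last first.
    by move=> j; under eq_fun do rewrite EFinM; exact: integrableZl.
  apply: eq_bigr => j _; under eq_integral do rewrite EFinM.
  by rewrite integralZl.
have tauE : (\int[tau]_b (Num.max (L b) 0)%:E =
    \int[pi]_p (Num.max (L p.1) 0)%:E)%E.
  transitivity (\int[pushforward pi fst]_b (Num.max (L b) 0)%:E)%E.
    by apply: eq_measure_integral => A mA _; exact/esym/pi1.
  by rewrite (ge0_integral_pushforward measurable_fst pi)// preimage_setT.
have lamE : (\int[lam]_b (Num.max (L b) 0)%:E =
    \int[pi]_p (Num.max (L p.2) 0)%:E)%E.
  transitivity (\int[pushforward pi snd]_b (Num.max (L b) 0)%:E)%E.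
    by apply: eq_measure_integral => A mA _; exact/esym/pi2.
  by rewrite (ge0_integral_pushforward measurable_snd pi)// preimage_setT.
rewrite tauE lamE.
have -> : (\int[pi]_p (Num.max (L p.2) 0)%:E =
    \int[pi]_(p in snd @^-1` N) (L p.2)%:E)%E.
  rewrite [RHS]integral_mkcond; apply: eq_integral => p _; rewrite patchE.
  case: ifPn => [|]; rewrite ?notin_setE ?inE /N/=.
    by move=> L0; rewrite max_l.
  by move/negP; rewrite -ltNge => L0; rewrite max_r// ltW.
rewrite intL; last exact: measurable_snd.
(* The event depends on the second component only, so the coupling condition applies to each
   mass. *)
under eq_bigr do rewrite -piE//.
rewrite -(intL fst); last exact: measurable_fst.
have mL1 : measurable_fun setT
    (fun p : signal i * signal i => (Num.max (L p.1) 0)%:E).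
  by apply: (measurableT_comp mLmax); exact: measurable_fst.
have intL1 : pi.-integrable setT (fun p => (L p.1)%:E).
  under eq_fun do rewrite /L -sumEFin; apply: integrable_sum => // j _.
  under eq_fun do rewrite EFinM; apply: integrableZl => //.
  exact: intq _ _ measurable_fst.
apply: (@le_trans _ _ (\int[pi]_(p in snd @^-1` N) (Num.max (L p.1) 0)%:E)%E).
  apply: le_integral => //.
  - exact: integrableS intL1.
  - apply: (integrableS measurableT) => //.
    apply: le_integrable intL1 => //= p _; rewrite lee_fin.
    by case: (leP (L p.1) 0) => // _; rewrite normr0.
  - by move=> p _; rewrite lee_fin le_max lexx.
by apply: ge0_subset_integral.
Qed.

Variable g : belief R (states Theta).

(** With the other signals fixed, [a] does not vary with the signal of bidder [i]. The integrand is
    then the positive part of a linear form in that signal, and Jensen's inequality applies inside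
    the outer integral. *)
Lemma integral_max0_le (lam : experiments R Theta) i
    (nu : probability (signal i) R) (a : states Theta -> signals -> R) :
  mps (lam i) nu ->
  (forall theta, measurable_fun setT (a theta)) ->
  (forall theta s b, a theta (@put _ _ signal i (s, b)) = a theta s) ->
  (\int[prodP (eqtype.dfwith lam nu)]_s
     (Num.max (\sum_theta weight g s theta * a theta s) 0)%:E <=
   \int[prodP lam]_s
     (Num.max (\sum_theta weight g s theta * a theta s) 0)%:E)%E.
Proof.
move=> hmps ma aput.
pose H s := (Num.max (\sum_theta weight g s theta * a theta s) 0)%:E.
have mH : measurable_fun setT H.
  apply/measurable_EFinP; apply: measurable_maxr => //.
  apply: measurable_sum => theta; apply: measurable_funM => //.
  exact: measurable_weight.
have H0 s : (0 <= H s)%E by rewrite lee_fin le_max lexx orbT.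
rewrite -[in X in (_ <= X)%E](dfwith_self lam i).
rewrite !integral_prodP_dfwith//.
have mput (mu : probability (signal i) R) : measurable_fun setT
    (fun s : signals => \int[mu]_b H (put (s, b)))%E.
  apply: (@measurable_fun_fubini_tonelli_F _ _ _ _ _ mu
    (fun p => H (put p))) => //.
  by apply: measurableT_comp => //; exact: measurable_put.
apply: ge0_le_integral => //; try exact: mput.
  by move=> s _; apply: integral_ge0 => b _; exact: H0.
move=> s _.
(* This is the coefficient of [b (theta i)]; the linear form is indexed by state profiles rather
   than by the states of bidder [i]. *)
pose c (theta : states Theta) :=
  g theta * a theta s * (marginal g (theta i))^-1 *
  \prod_(j | j != i) (s j (theta j) / marginal g (theta j)).
have HE b : H (put (s, b)) =
    (Num.max (\sum_theta c theta * b (theta i)) 0)%:E.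
  congr (Num.max _ _)%:E; apply: eq_bigr => theta _.
  by rewrite aput weight_put /c; ring.
have intE (mu : probability (signal i) R) : (\int[mu]_b H (put (s, b)) =
    \int[mu]_b (Num.max (\sum_theta c theta * b (theta i)) 0)%:E)%E.
  by apply: eq_integral => b _; exact: HE.
rewrite [leLHS](intE nu) [leRHS](intE (lam i)).
exact: (mps_integral_max0 c (fun theta : states Theta => theta i)).
Qed.

(** The comparison applied to [a] and to [- a] forces both positive parts to have integral 0. An
    almost sure identity linear in the signal of bidder [i] thus survives a garbling. *)
Lemma weight_comb_ae0 (lam : experiments R Theta) i
    (nu : probability (signal i) R) (a : states Theta -> signals -> R) :
  mps (lam i) nu ->
  (forall theta, measurable_fun setT (a theta)) ->
  (forall theta s b, a theta (@put _ _ signal i (s, b)) = a theta s) ->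
  {ae prodP lam, forall s, \sum_theta weight g s theta * a theta s = 0} ->
  {ae prodP (eqtype.dfwith lam nu),
    forall s, \sum_theta weight g s theta * a theta s = 0}.
Proof.
move=> hmps ma aput a0.
pose H (a : states Theta -> signals -> R) s :=
  Num.max (\sum_theta weight g s theta * a theta s) 0.
have half (a' : states Theta -> signals -> R) :
    (forall theta, measurable_fun setT (a' theta)) ->
    (forall theta s b, a' theta (@put _ _ signal i (s, b)) = a' theta s) ->
    {ae prodP lam, forall s, \sum_theta weight g s theta * a' theta s = 0} ->
    {ae prodP (eqtype.dfwith lam nu), forall s, H a' s = 0}.
  move=> ma' a'put a'0.
  have mH : measurable_fun setT (EFin \o H a').
    apply/measurable_EFinP; apply: measurable_maxr => //.
    apply: measurable_sum => theta; apply: measurable_funM => //.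
    exact: measurable_weight.
  have H0 s : (0 <= (H a' s)%:E)%E by rewrite lee_fin le_max lexx orbT.
  have : (\int[prodP (eqtype.dfwith lam nu)]_s `|(EFin \o H a') s| = 0)%E.
    apply/eqP; rewrite eq_le integral_ge0// andbT.
    rewrite (eq_integral (EFin \o H a')) => [|s _]; last first.
      by rewrite gee0_abs//; exact: H0.
    apply: le_trans (integral_max0_le hmps ma' a'put) _.
    rewrite (ae_eq_integral (cst 0%E))// ?integral0//.
    by apply: filterS a'0 => s /= -> _; rewrite maxxx.
  move/(ae_eq_integral_abs _ measurableT mH).
  by apply: filterS => s /(_ Logic.I) /= [].
have h1 := half _ ma aput a0.
have h2 : {ae prodP (eqtype.dfwith lam nu),
    forall s, H (fun theta s => - a theta s) s = 0}.
  apply: half.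
  - by move=> theta; exact: measurableT_comp.
  - by move=> theta s b; rewrite aput.
  - apply: filterS a0 => s; under [in X in _ -> X]eq_bigr do rewrite mulrN.
    by rewrite sumrN => ->; rewrite oppr0.
apply: filterS2 h1 h2 => s; rewrite /H.
under [in X in _ -> X -> _]eq_bigr do rewrite mulrN.
rewrite sumrN; set S := \sum_theta _ => h1 h2.
have S0 : S <= 0 by rewrite -h1 le_max lexx.
have NS0 : - S <= 0 by rewrite -h2 le_max lexx.
by lra.
Qed.

End jensen.

(** * From almost every profile to the product of the supports *)

Section possible_profiles.
Context (R : realType) (n : nat) (Theta : 'I_n -> finPointedType).
Variables (g : belief R (states Theta)) (lam : experiments R Theta).

Local Notation signals := (signals R Theta).
Local Notation signal := (signal R Theta).

(** Neighborhoods for the uniform distance between masses; each basic one is a box of the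
    neighborhoods that define [support]. *)
Definition near_signals (s : signals) : set_system signals :=
  filter_from [set e : R | 0 < e]
    (fun e => [set s' : signals |
       forall i (x : Theta i), `|s' i x - s i x| < e]).

#[global] Instance near_signals_filter s : Filter (near_signals s).
Proof.
apply: filter_from_filter; first by exists 1 => /=.
move=> e1 e2 /= e10 e20; exists (Num.min e1 e2); first by rewrite /= lt_min e10.
by move=> s' /= h; split=> i x; have := h i x; rewrite lt_min => /andP[].
Qed.

Lemma cvg_mass (s : signals) i (x : Theta i) :
  (fun s' : signals => s' i x) @ near_signals s --> s i x.
Proof.
apply/cvgrPdist_lt => e e0; exists e => // s' h /=.
by rewrite distrC; exact: h.
Qed.

Lemma cvg_weight (s : signals) theta :
  (weight g ^~ theta) @ near_signals s --> weight g s theta.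
Proof.
apply: cvgM; first exact: cvg_cst.
apply: (cvg_big mul_continuous) => i _.
by apply: cvgM; [exact: cvg_mass|exact: cvg_cst].
Qed.

Lemma cvg_sum_weight (s : signals) (Q : pred (states Theta)) :
  (fun s' => \sum_(theta | Q theta) weight g s' theta) @ near_signals s -->
  \sum_(theta | Q theta) weight g s theta.
Proof.
by apply: (cvg_big add_continuous) => theta _; exact: cvg_weight.
Qed.

(* Every neighborhood of a profile in the product of the supports has positive
   mass. *)
Lemma ae_eq_support (s : signals) (f : signals -> R) :
  f @ near_signals s --> f s -> {ae prodP lam, forall s', f s' = 0} ->
  (forall i, Defs.support (lam i) (s i)) -> f s = 0.
Proof.
move=> cf [N [mN N0 fN]] hs; apply: contrapT => /eqP fs0.
have [e /= e0 he] := cvgr_neq0 _ cf fs0.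
(* The box with these sides lies in the null set [N], while each side has positive mass by the
   definition of [support]. *)
pose B i := [set b : signal i | forall x, `|b x - s i x| < e].
have mB i : measurable (B i).
  rewrite (_ : B i = \bigcap_(x in [set: Theta i])
      [set b : signal i | `|b x - s i x| < e]); last first.
    by apply/seteqP; split=> b h x //=; exact: h.
  apply: fin_bigcap_measurable; first exact: finite_finset.
  move=> x _.
  have mf : measurable_fun setT (fun b : signal i => `|b x - s i x|).
    apply: measurableT_comp => //; apply: measurable_funB => //.
    exact: measurable_mass.
  have := mf measurableT _ (measurable_itv `]-oo, e[); rewrite setTI.
  by congr (measurable _); apply/seteqP; split=> b; rewrite /= in_itv.
have : (prodP lam (box B) <= 0)%E.
  rewrite -N0; apply: le_measure; rewrite ?inE//; first exact: measurable_box.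
  by move=> s' Bs'; apply: fN => /= fs'0; have := he _ Bs'; rewrite fs'0 eqxx.
rewrite leNgt => /negP; apply.
rewrite [X in (_ < X)%E]prodP_box//.
apply: (big_ind (fun x : \bar R => (0 < x)%E)) => //.
  by move=> x y x0 y0; exact: mule_gt0.
by move=> i _; exact: hs.
Qed.

End possible_profiles.

(** * The auction *)

Section max_over.
Context (R : realType) (n : nat).
Implicit Types (P : pred 'I_n) (f : 'I_n -> R).

(** A member of [P] keeps the default [-oo], which [fine] would send to 0, from being the
    maximum. *)
Lemma max_over_witness P f i : P i -> exists2 j, P j & max_over P f = f j.
Proof.
move=> Pi; have [||j Pj fj] := @eq_bigmax _ _ _ -oo%E i P (EFin \o f) => //.
  by move=> j _; exact: leNye.
by exists j => //; rewrite /max_over fj.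
Qed.

Lemma max_over_ge P f i : P i -> f i <= max_over P f.
Proof.
move=> Pi; rewrite -lee_fin /max_over fineK.
  exact: (le_bigmax_cond -oo%E (fun j => (f j)%:E)).
have [||j Pj fj] := @eq_bigmax _ _ _ -oo%E i P (EFin \o f) => //.
  by move=> j _; exact: leNye.
by rewrite fj.
Qed.

Lemma max_over_eq P f i : P i -> (forall j, P j -> f j <= f i) ->
  max_over P f = f i.
Proof.
move=> Pi fi; apply/eqP; rewrite eq_le max_over_ge// andbT.
by have [j Pj ->] := max_over_witness f Pi; exact: fi.
Qed.

Lemma eq_max_over P f h : (forall i, P i -> f i = h i) ->
  max_over P f = max_over P h.
Proof. by move=> fh; congr fine; apply: eq_bigr => i /fh ->. Qed.

(** Seeding with a value attained on [P] stays within the reals, so measurability follows by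
    induction on binary maxima. *)
Lemma max_over_bigmax P f i : P i ->
  max_over P f = \big[Num.max/f i]_(j | P j) f j.
Proof.
move=> Pi; have [j Pj fj] := max_over_witness f Pi.
apply/eqP; rewrite eq_le {1}fj le_bigmax_cond//=.
by apply: bigmax_le => [|k Pk]; exact: max_over_ge.
Qed.

Lemma measurable_max_over d (T : measurableType d) P (f : 'I_n -> T -> R) i :
  P i -> (forall j, measurable_fun setT (f j)) ->
  measurable_fun setT (fun x => max_over P (f ^~ x)).
Proof.
move=> Pi mf.
under eq_fun do rewrite (max_over_bigmax _ Pi).
elim: (index_enum _) => [|j r IH].
  by under eq_fun do rewrite big_nil; exact: mf.
under eq_fun do rewrite big_cons.
by case: (P j) => //; exact: measurable_maxr.
Qed.

End max_over.

(** * Posterior values and consistent profiles *)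

Section values.
Context (R : realType) (n : nat) (T : 'I_n -> Type).
Context (Theta : 'I_n -> finPointedType).
Variables (v : forall i, T i -> Theta i -> R) (g : belief R (states Theta)).

Local Notation signals := (signals R Theta).
Local Notation signal := (signal R Theta).

Lemma density0_weight s theta : density g s = 0 -> weight g s theta = 0.
Proof.
move/eqP; rewrite psumr_eq0 => [/allP/(_ theta)|theta' _]; last first.
  exact: weight_ge0.
by rewrite mem_index_enum => /(_ isT)/eqP.
Qed.

(** Clearing the denominator is harmless: where the density is 0, all the weights are 0. *)
Lemma value_density i (b : T i) s :
  value v g b s * density g s = \sum_theta weight g s theta * v b (theta i).
Proof.
rewrite /value mulr_suml; apply: eq_bigr => theta _; rewrite /posterior.
have [d0|d0] := eqVneq (density g s) 0.
  by rewrite d0 mulr0 density0_weight// mul0r.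
by rewrite mulrAC divfK.
Qed.

Lemma measurable_value i (b : T i) : measurable_fun setT (value v g b).
Proof.
apply: measurable_sum => theta; apply: measurable_funM => //.
apply: measurable_funM; first exact: measurable_weight.
(* The inverse of the density is written as a real power, a measurable function. *)
under eq_fun do rewrite -powR_inv1 ?density_ge0//.
apply: (measurableT_comp (measurable_powR (-1))); exact: measurable_density.
Qed.

Lemma measurable_own_value i (b : T i) :
  measurable_fun setT (fun s : signals => own_value v b (s i)).
Proof.
apply: measurable_sum => x; apply: measurable_funM => //.
exact: measurable_mass_coord.
Qed.

(** The posterior law of each state is the signal about it, with denominators cleared: a polynomial
    identity that makes sense at density 0 as well. *)
Definition consistent (s : signals) : Prop := forall i (x : Theta i),
  \sum_(theta : states Theta | theta i == x) weight g s theta =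
  s i x * density g s.

Lemma consistent_own_value s i (b : T i) : consistent s ->
  \sum_theta weight g s theta * v b (theta i) =
  own_value v b (s i) * density g s.
Proof.
move=> cs; rewrite /own_value mulr_suml.
pose pr (theta : states Theta) := theta i.
rewrite (partition_big pr predT)//=; apply: eq_bigr => x _.
rewrite mulrAC -cs mulr_suml; apply: eq_bigr => theta /eqP <-.
by [].
Qed.

Lemma consistent_value s i (b : T i) : consistent s -> 0 < density g s ->
  value v g b s = own_value v b (s i).
Proof.
move=> cs d0; apply: (mulIf (lt0r_neq0 d0)).
by rewrite value_density consistent_own_value.
Qed.

Lemma consistent_ae (lam : experiments R Theta) :
  (forall i, experiment g (lam i)) -> (forall i, state_indep g lam i) ->
  {ae prodP lam, forall s, consistent s}.
Proof.
move=> hlam hind; apply: filter_forall => i; apply: filter_forall => x.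
by apply: filterS (sum_weight_ae hlam x (hind i)) => s /(_ Logic.I)[].
Qed.

(** The difference of the two sides is continuous in the masses and almost everywhere 0, so it
    vanishes on the product of the supports. *)
Lemma possible_consistent (lam : experiments R Theta) s :
  (forall i, experiment g (lam i)) -> (forall i, state_indep g lam i) ->
  (forall i, Defs.support (lam i) (s i)) -> consistent s.
Proof.
move=> hlam hind hs i x; apply/eqP; rewrite -subr_eq0; apply/eqP.
pose f s := \sum_(theta : states Theta | theta i == x) weight g s theta -
  s i x * density g s.
apply: (@ae_eq_support _ _ _ lam s f) => //.
  apply: cvgB; first exact: cvg_sum_weight.
  by apply: cvgM; [exact: cvg_mass|exact: (@cvg_sum_weight _ _ _ g s predT)].
by apply: filterS (consistent_ae hlam hind) => s' cs'; rewrite /f cs' subrr.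
Qed.

(** Profiles of density 0 form a null event of the signal law. *)
Lemma ae_signal_law (lam : experiments R Theta) (Q : set signals) :
  {ae prodP lam, forall s, 0 < density g s -> Q s} ->
  {ae signal_law g lam, forall s, Q s}.
Proof.
move=> [N [mN N0 QN]].
pose Z := [set s : signals | density g s = 0].
have mZ : measurable Z.
  have := @measurable_density _ _ _ g measurableT _ (measurable_set1 0).
  by rewrite setTI.
exists (N `|` Z); split; first exact: measurableU.
  apply/eqP; rewrite -measure_le0; apply: le_trans (measureU2 _ mN mZ) _.
  rewrite /= /signal_law [X in (X + _)%E]null_set_integral//; last first.
    by apply/measurable_EFinP/measurable_funTS; exact: measurable_density.
  by rewrite add0e integral0_eq// => s ->.
move=> s /= nQ; have [d0|d0] := eqVneq (density g s) 0; first by right.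
left; apply: QN => /= h; apply: nQ; apply: h.
by rewrite lt_def d0 density_ge0.
Qed.

End values.

(** * Incentives and welfare *)

Section auction.
Context (R : realType) (n : nat) (T : 'I_n -> Type).
Context (Theta : 'I_n -> finPointedType).
Variables (v : forall i, T i -> Theta i -> R) (g : belief R (states Theta)).
Variable (tie : {set 'I_n} -> 'I_n).
Hypothesis n_gt1 : (1 < n)%N.
Hypothesis htie : forall A : {set 'I_n}, A != finset.set0 -> tie A \in A.

Local Notation signals := (signals R Theta).
Local Notation M := (expected_vickrey v g tie).
Local Notation W := (winner v g tie).

Lemma exists_other (i : 'I_n) : exists j : 'I_n, j != i.
Proof.
have n_gt0 : (0 < n)%N by exact: ltnW.
have [i0|i0] := eqVneq i (Ordinal n_gt0).
  by exists (Ordinal n_gt1); rewrite i0.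
by exists (Ordinal n_gt0); rewrite eq_sym.
Qed.

Lemma value_winner (b : profile T) s j :
  value v g (b j) s <= value v g (b (W b s)) s.
Proof.
have : W b s \in
    [set i | [forall j, value v g (b j) s <= value v g (b i) s]]%SET.
  apply: htie; apply/finset.set0Pn.
  have [i _ iE] :=
    @max_over_witness _ _ predT (fun j => value v g (b j) s) j isT.
  exists i; rewrite inE; apply/forallP => k; rewrite -iE.
  exact: (@max_over_ge _ _ predT (fun j => value v g (b j) s)).
by rewrite inE => /forallP.
Qed.

Lemma winner_max (b : profile T) s :
  value v g (b (W b s)) s = max_over predT (fun j => value v g (b j) s).
Proof. by apply/esym/max_over_eq => // j _; exact: value_winner. Qed.

Lemma welfareE t s :
  welfare v g M t s = max_over predT (fun j => value v g (t j) s).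
Proof.
rewrite /welfare (bigD1 (W t s))//= eqxx mul1r winner_max big1 ?addr0// => i.
by move=> /negbTE ->; rewrite mul0r.
Qed.

(* A bidder's surplus when it decides whether to trade at the price set by the
   others' bids; truthful reporting makes the auction decide optimally. *)
Definition surplus (i : 'I_n) (t : profile T) (s : signals) : R :=
  Num.max (value v g (t i) s -
    max_over (fun j => j != i) (fun j => value v g (t j) s)) 0.

(** The price does not involve the bidder's own report, so its payoff is either value minus price or
    0. *)
Lemma utility_le_surplus i (t b : profile T) s :
  (forall j, j != i -> b j = t j) -> utility v g M (t i) b s <= surplus i t s.
Proof.
move=> bt; rewrite /utility /surplus /=; case: eqP => [_|_].
  rewrite mul1r (eq_max_over (h := fun j => value v g (t j) s)) => [|j ji].
    by rewrite le_max lexx.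
  by rewrite bt.
by rewrite mul0r subr0 le_max lexx orbT.
Qed.

(** A truthful winner has the highest value, so its gain is nonnegative; for a loser the winner is
    among the others, so the price is at least its own value. *)
Lemma truthful_utility i (t : profile T) s :
  utility v g M (t i) t s = surplus i t s.
Proof.
rewrite /utility /surplus /=; have [j ji] := exists_other i; case: eqP => iW.
  rewrite mul1r max_l// subr_ge0.
  have [k ki ->] := @max_over_witness _ _ (fun j => j != i)
    (fun j => value v g (t j) s) j ji.
  by rewrite iW; exact: value_winner.
rewrite mul0r subr0 max_r// subr_le0.
apply: le_trans (value_winner t s i) _.
apply: (@max_over_ge _ _ (fun j => j != i) (fun j => value v g (t j) s)).
by apply/eqP => /esym.
Qed.

Lemma expost_IR_expected_vickrey : expost_IR v g M.
Proof. by move=> i t s; rewrite truthful_utility /surplus le_max lexx orbT. Qed.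

Lemma measurable_surplus i t : measurable_fun setT (surplus i t).
Proof.
have [j ji] := exists_other i.
apply: measurable_maxr => //; apply: measurable_funB.
  exact: measurable_value.
apply: (@measurable_max_over _ _ _ _ (fun j => j != i)
  (fun j s => value v g (t j) s) _ ji) => k.
exact: measurable_value.
Qed.

(** Computed from the others' own signals, this price does not vary with the signal of bidder [i],
    unlike the one the auction charges at an arbitrary profile. *)
Definition price (i : 'I_n) (t : profile T) (s : signals) : R :=
  max_over (fun j => j != i) (fun j => own_value v (t j) (s j)).

Lemma measurable_price i t : measurable_fun setT (price i t).
Proof.
have [j ji] := exists_other i.
apply: (@measurable_max_over _ _ _ _ (fun j => j != i)
  (fun j (s : signals) => own_value v (t j) (s j)) _ ji) => k.
exact: measurable_own_value.
Qed.

(** Written as a vanishing combination of weights to fit [weight_comb_ae0]. Bidder [i] is left out: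
    its own identity would be quadratic in its signal. *)
Definition others_consistent (i : 'I_n) (t : profile T) (s : signals) : Prop :=
  forall j, j != i ->
  \sum_theta weight g s theta *
    (v (t j) (theta j) - own_value v (t j) (s j)) = 0.

Lemma consistent_others i t s : consistent g s -> others_consistent i t s.
Proof.
move=> cs j _; under eq_bigr do rewrite mulrBr.
by rewrite sumrB consistent_own_value// -mulr_suml mulrC subrr.
Qed.

(** The nonnegative density moves inside the maximum, and the others' identities turn their
    posterior values into [price]. *)
Lemma surplus_density i t s : others_consistent i t s ->
  surplus i t s * density g s =
  Num.max (\sum_theta weight g s theta * (v (t i) (theta i) - price i t s)) 0.
Proof.
move=> oc; rewrite /surplus maxr_pMl ?density_ge0// mul0r; congr Num.max.
under [RHS]eq_bigr do rewrite mulrBr.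
rewrite sumrB -value_density -mulr_suml -/(density g s) mulrBl.
rewrite [_ * price _ _ _]mulrC.
congr (_ - _); have [->|d0] := eqVneq (density g s) 0; first by rewrite !mulr0.
congr (_ * _); apply: eq_max_over => j ji; apply: (mulIf d0).
apply/eqP; rewrite -subr_eq0; apply/eqP; rewrite -[RHS](oc j ji).
under [RHS]eq_bigr do rewrite mulrBr.
by rewrite sumrB -value_density -mulr_suml [X in _ - X]mulrC.
Qed.

Lemma integral_surplus (lam : experiments R Theta) i t :
  {ae prodP lam, forall s, others_consistent i t s} ->
  (\int[signal_law g lam]_s (surplus i t s)%:E =
   \int[prodP lam]_s (Num.max
     (\sum_theta weight g s theta * (v (t i) (theta i) - price i t s)) 0)%:E)%E.
Proof.
move=> oc; have mS := measurable_surplus i t.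
rewrite integral_signal_law; last 2 first.
- exact/measurable_EFinP.
- by move=> s; rewrite lee_fin le_max lexx orbT.
apply: ae_eq_integral => //.
- apply/measurable_EFinP; apply: measurable_funM => //.
  exact: measurable_density.
- apply/measurable_EFinP; apply: measurable_maxr => //.
  apply: measurable_sum => theta; apply: measurable_funM.
    exact: measurable_weight.
  by apply: measurable_funB => //; exact: measurable_price.
by apply: filterS oc => s oc _; rewrite -surplus_density.
Qed.

Lemma expost_IIC_expected_vickrey (tau : experiments R Theta) :
  (forall i, experiment g (tau i)) -> (forall i, state_indep g tau i) ->
  expost_IIC v g tau M.
Proof.
move=> htau hind i t b lam hmps; rewrite /expected_utility.
have cons := consistent_ae htau hind.
have oc : {ae prodP tau, forall s, others_consistent i t s}.
  by apply: filterS cons => s; exact: consistent_others.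
(* The others' identities hold under truthful revelation and are carried over to the garbled law. *)
have oc' : {ae prodP (eqtype.dfwith tau lam),
    forall s, others_consistent i t s}.
  apply: filter_forall => j; have [_|ji] := eqVneq j i.
    by apply: filterE.
  have H : {ae prodP (eqtype.dfwith tau lam), forall s,
      \sum_theta weight g s theta *
        (v (t j) (theta j) - own_value v (t j) (s j)) = 0}.
    apply: (@weight_comb_ae0 _ _ _ g tau i lam (fun theta s =>
      v (t j) (theta j) - own_value v (t j) (s j))) => //.
    - move=> theta; apply: measurable_funB => //.
      exact: measurable_own_value.
    - by move=> theta s x; rewrite /put dfwith_out// eq_sym.
    - by apply: filterS oc => s /(_ j ji).
  by apply: filterS H.
(* The deviation is first bounded by the surplus under the garbled law; Jensen's inequality then
   compares the surplus under the two laws. *)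
apply: (@le_trans _ _ (\int[signal_law g (eqtype.dfwith tau lam)]_s
    (surplus i t s)%:E)%E).
  apply: le_integral_ge0 => s; first by rewrite lee_fin le_max lexx orbT.
  rewrite lee_fin utility_le_surplus// => j ji.
  by rewrite dfwith_out// eq_sym.
rewrite integral_surplus//.
under [leRHS]eq_integral do rewrite truthful_utility.
rewrite integral_surplus//.
apply: (@integral_max0_le _ _ _ g tau i lam
  (fun theta s => v (t i) (theta i) - price i t s)) => //.
- move=> theta; apply: measurable_funB => //; exact: measurable_price.
- move=> theta s x; congr (_ - _); apply: eq_max_over => j ji.
  by rewrite /put dfwith_out// eq_sym.
Qed.

End auction.

Theorem proposition5p3 (R : realType) (n : nat) (hn : (1 < n)%N)
    (T : 'I_n -> Type) (Theta : 'I_n -> finPointedType)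
    (v : forall i, T i -> Theta i -> R) (g : belief R (states Theta))
    (tau : experiments R Theta) (tie : {set 'I_n} -> 'I_n)
    (htau : forall i, experiment g (tau i))
    (hindep : forall i, state_indep g tau i)
    (htie : forall A : {set 'I_n}, A != finset.set0 -> tie A \in A) :
  let M := expected_vickrey v g tie in
  expost_IIC v g tau M /\
  expost_IR v g M /\
  (forall (t : profile T) (sigma : signals R Theta), possible g tau sigma ->
     exists i, alloc M t sigma =1 (fun j => (j == i)%:R) /\
       own_value v (t i) (sigma i) =
         max_over xpredT (fun j => own_value v (t j) (sigma j))) /\
  (forall t : profile T,
     (\int[signal_law g tau]_sigma (welfare v g M t sigma)%:E =
      \int[signal_law g tau]_sigma
        (max_over xpredT (fun j => own_value v (t j) (sigma j)))%:E)%E).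
Proof.
move=> M; split; first exact: expost_IIC_expected_vickrey.
split; first exact: expost_IR_expected_vickrey.
have i0 : 'I_n := Ordinal (ltnW hn).
split=> [t sigma [hs d0]|t].
  have cs := possible_consistent htau hindep hs.
  exists (winner v g tie t sigma); split => //.
  rewrite -(consistent_value v _ cs d0) (winner_max v g htie).
  apply: eq_max_over => j _.
  exact: consistent_value.
apply: ae_eq_integral => //.
- apply/measurable_EFinP; rewrite (funext (welfareE v g htie t)).
  apply: (@measurable_max_over _ _ _ _ predT
    (fun j s => value v g (t j) s) i0) => // j.
  exact: measurable_value.
- apply/measurable_EFinP; apply: (@measurable_max_over _ _ _ _ predT
    (fun j (s : signals R Theta) => own_value v (t j) (s j)) i0) => // j.
  exact: measurable_own_value.
(* The integrands agree at consistent profiles of positive density, which are almost sure under the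
   signal law. *)
suff : {ae signal_law g tau, forall s, welfare v g M t s =
    max_over xpredT (fun j => own_value v (t j) (s j))}.
  by apply: filterS => s -> _.
apply: ae_signal_law; apply: filterS (consistent_ae htau hindep) => s cs d0.
by rewrite welfareE//; apply: eq_max_over => j _; exact: consistent_value.
Qed.
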